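(* There is an absolute constant $C>0$ such that the following holds. Let $d\ge 1$, let $\mathcal{W}\subseteq\mathbb{R}^d$ be a convex set with nonempty interior, and let $G,\beta,\rho,\mu>0$. Suppose that for all $t\ge 1$ the functions $f_t$ and $\hat f_t$ satisfy Assumptions 1 and 2 (written out in the context) on $\mathcal{W}$ with the constants $G,\beta,\rho,\mu$. Let $0<\alpha\le\min\{\frac{1}{2\beta},\frac{\mu}{8\rho G}\}$ and let the update procedure be $U_t(\mathbf{w})=\mathbf{w}-\alpha\nabla\hat f_t(\mathbf{w})$, where $U_t$ maps $\mathcal{W}$ into $\mathcal{W}$ for every $t$. Let $(\mathbf{w}_t)_{t\ge1}$ be a sequence in $\mathcal{W}$ generated by the FTML (follow the meta leader) algorithm, that is, $\mathbf{w}_1\in\mathcal{W}$ is arbitrary and $$\mathbf{w}_{t+1}\in\arg\min_{\mathbf{w}\in\mathcal{W}}\ \sum_{k=1}^t f_k\big(U_k(\mathbf{w})\big)\qquad (t\ge1).$$ Then for every $T\ge2$, $$\sum_{t=1}^T f_t\big(U_t(\mathbf{w}_t)\big)-\min_{\mathbf{w}\in\mathcal{W}}\sum_{t=1}^T f_t\big(U_t(\mathbf{w})\big)\ \le\ C\,\frac{32G^2}{\mu}\log T,$$ i.e. the regret of FTML is $O\big(\frac{32G^2}{\mu}\log T\big)$.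
   Context: Norms are Euclidean for vectors and the induced operator norm for matrices. A function $f$ satisfies Assumptions 1 and 2 on $\mathcal{W}$ with constants $G,\beta,\rho,\mu$ if it is twice differentiable on an open set containing $\mathcal{W}$ and for all $\theta,\phi\in\mathcal{W}$: Assumption 1: (1) $\|\nabla f(\theta)\|\le G$; (2) $\|\nabla f(\theta)-\nabla f(\phi)\|\le\beta\|\theta-\phi\|$; (3) $\|\nabla^2 f(\theta)-\nabla^2 f(\phi)\|\le\rho\|\theta-\phi\|$. Assumption 2: $f$ is convex on $\mathcal{W}$ and $\|\nabla f(\theta)-\nabla f(\phi)\|\ge\mu\|\theta-\phi\|$. The minimizers in the definition of the FTML iterates are assumed to exist (this is part of the algorithm being well defined). In the online protocol, at round $t$ the agent plays $\mathbf{w}_t$, then the task ($f_t$ and $U_t$) is revealed, and the agent incurs loss $f_t(U_t(\mathbf{w}_t))$. *)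

(* Defs.v *)
From mathcomp Require Import all_boot all_order all_algebra.
From mathcomp Require Import all_classical all_reals all_analysis.

Set Implicit Arguments.
Unset Strict Implicit.
Unset Printing Implicit Defensive.

Import Order.TTheory GRing.Theory Num.Theory.
Import numFieldNormedType.Exports.

Local Open Scope classical_set_scope.
Local Open Scope ring_scope.

(* The library norm `|u| on 'rV[R]_d is the sup norm, hence this definition.
   Both norms induce the same topology and the same notion of
   differentiability, so openness, interior and [differentiable] are the
   library ones. *)
Definition enorm (R : realType) (d : nat) (u : 'rV[R]_d) : R :=
  Num.sqrt (\sum_(i < d) u ord0 i ^+ 2).

(* Matrices act on row vectors, as for the library Jacobian:
   v *m 'J g x is the directional derivative of g at x along v. *)
Definition opnorm (R : realType) (d : nat) (A : 'M[R]_d) : R :=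
  sup [set enorm (u *m A) | u in [set u : 'rV[R]_d | enorm u <= 1]].

Definition grad (R : realType) (d : nat) (f : 'rV[R]_d -> R)
    (x : 'rV[R]_d) : 'rV[R]_d :=
  \row_(i < d) 'D_(delta_mx ord0 i) f x.

Definition hessian (R : realType) (d : nat) (f : 'rV[R]_d -> R)
    (x : 'rV[R]_d) : 'M[R]_d :=
  'J (grad f) x.

(* Values of [f] outside the open set [O] are irrelevant: differentiability,
   [grad] and [hessian] at a point of [O] only depend on [f] near that point. *)
Definition twice_differentiable_around (R : realType) (d : nat)
    (W : set 'rV[R]_d) (f : 'rV[R]_d -> R) : Prop :=
  exists O : set 'rV[R]_d,
    [/\ open O, W `<=` O &
        forall x, O x -> differentiable f x /\ differentiable (grad f) x].

Definition assumption1 (R : realType) (d : nat) (G beta rho : R)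
    (W : set 'rV[R]_d) (f : 'rV[R]_d -> R) : Prop :=
  forall theta phi, W theta -> W phi ->
    [/\ enorm (grad f theta) <= G,
        enorm (grad f theta - grad f phi) <= beta * enorm (theta - phi) &
        opnorm (hessian f theta - hessian f phi) <= rho * enorm (theta - phi)].

Definition assumption2 (R : realType) (d : nat) (mu : R)
    (W : set 'rV[R]_d) (f : 'rV[R]_d -> R) : Prop :=
  convex_function W f /\
  forall theta phi, W theta -> W phi ->
    mu * enorm (theta - phi) <= enorm (grad f theta - grad f phi).

Definition assumptions12 (R : realType) (d : nat) (G beta rho mu : R)
    (W : set 'rV[R]_d) (f : 'rV[R]_d -> R) : Prop :=
  [/\ twice_differentiable_around W f, assumption1 G beta rho W f &
      assumption2 mu W f].

Definition update (R : realType) (d : nat) (alpha : R) (fhat : 'rV[R]_d -> R)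
    (w : 'rV[R]_d) : 'rV[R]_d :=
  w - alpha *: grad fhat w.

Definition argmin (R : realType) (T : Type) (W : set T) (F : T -> R) : set T :=
  [set u | W u /\ forall v, W v -> F u <= F v].

Definition cumulative_loss (R : realType) (d : nat) (alpha : R)
    (f fhat : nat -> 'rV[R]_d -> R) (t : nat) (u : 'rV[R]_d) : R :=
  \sum_(1 <= k < t.+1) f k (update alpha (fhat k) u).

(* Rounds are numbered from 1; index 0 of [f], [fhat] and [w] is unused. *)
Definition FTML (R : realType) (d : nat) (alpha : R)
    (f fhat : nat -> 'rV[R]_d -> R) (W : set 'rV[R]_d)
    (w : nat -> 'rV[R]_d) : Prop :=
  W (w 1%N) /\
  forall t, (1 <= t)%N -> argmin W (cumulative_loss alpha f fhat t) (w t.+1).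

(* Main.v *)
(** Along a segment of direction [v] the derivative of [f \o U] is
    [<grad f (U x_s), M_s v>] with [M_s v = v - alpha v H^_s], where [H^_s] is
    the Hessian of [fhat] and need not be differentiable.  Growth of this
    function of [s] is therefore read off one-sidedly at each point: freezing
    [M_s] at [s = p], the variation of [grad f] contributes the Hessian form of
    [f] at [M_p v], a vector of length at least [|v| / 2], hence at least
    [(mu/4) |v|^2]; moving [M_s] costs at most
    [alpha rho G |v|^2 <= (mu/8) |v|^2].  So [f \o U] is
    [mu/8]-strongly convex, and it is [2G]-Lipschitz.

    That Hessians are bounded below by [mu], and not merely expanding, comes
    from their symmetry and positivity, both read off second differences of
    [f]; the boundary of [W] is reached by the Lipschitz bound on the Hessian.

    The regret is at most the sum of [F_t(w_t) - F_t(w_{t+1})]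
    (be-the-leader), and strong convexity of the cumulative loss makes the
    [t]-th term [O(G^2 / (mu t))]. *)

Require Import Defs.
From mathcomp Require Import all_boot all_order all_algebra.
From mathcomp Require Import all_classical all_reals all_analysis.
From mathcomp Require Import ring lra.

Set Implicit Arguments.
Unset Strict Implicit.
Unset Printing Implicit Defensive.

Import Order.TTheory GRing.Theory Num.Theory.
Import numFieldNormedType.Exports.

Local Open Scope classical_set_scope.
Local Open Scope ring_scope.

(** * Euclidean inner product and norm *)

Section InnerProduct.
Context {R : realType} {d : nat}.
Implicit Types (u v w : 'rV[R]_d) (A : 'M[R]_d).

Definition dot u v : R := (u *m v^T) ord0 ord0.

Lemma dotE u v : dot u v = \sum_i u ord0 i * v ord0 i.
Proof. by rewrite /dot mxE; apply: eq_bigr => i _; rewrite mxE. Qed.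

Lemma dotC u v : dot u v = dot v u.
Proof. by rewrite !dotE; apply: eq_bigr => i _; rewrite mulrC. Qed.

Lemma dotDl u v w : dot (u + v) w = dot u w + dot v w.
Proof. by rewrite /dot mulmxDl mxE. Qed.

Lemma dotZl a u v : dot (a *: u) v = a * dot u v.
Proof. by rewrite /dot -scalemxAl mxE. Qed.

Lemma dotNl u v : dot (- u) v = - dot u v.
Proof. by rewrite -scaleN1r dotZl mulN1r. Qed.

Lemma dotBl u v w : dot (u - v) w = dot u w - dot v w.
Proof. by rewrite dotDl dotNl. Qed.

Lemma dotDr u v w : dot u (v + w) = dot u v + dot u w.
Proof. by rewrite dotC dotDl !(dotC u). Qed.

Lemma dotZr a u v : dot u (a *: v) = a * dot u v.
Proof. by rewrite dotC dotZl dotC. Qed.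

Lemma dotNr u v : dot u (- v) = - dot u v.
Proof. by rewrite dotC dotNl dotC. Qed.

Lemma dotBr u v w : dot u (v - w) = dot u v - dot u w.
Proof. by rewrite dotDr dotNr. Qed.

Lemma dotv_ge0 u : 0 <= dot u u.
Proof. by rewrite dotE sumr_ge0// => i _; rewrite -expr2 sqr_ge0. Qed.

Lemma enormE u : enorm u = Num.sqrt (dot u u).
Proof. by rewrite /enorm dotE. Qed.

Lemma enorm_ge0 u : 0 <= enorm u.
Proof. exact: sqrtr_ge0. Qed.

Lemma sqr_enorm u : enorm u ^+ 2 = dot u u.
Proof. by rewrite enormE sqr_sqrtr// dotv_ge0. Qed.

Lemma enormZ a u : enorm (a *: u) = `|a| * enorm u.
Proof.
by rewrite !enormE dotZl dotZr mulrA -expr2 sqrtrM ?sqr_ge0// sqrtr_sqr.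
Qed.

Lemma enormN u : enorm (- u) = enorm u.
Proof. by rewrite -scaleN1r enormZ normrN1 mul1r. Qed.

Lemma enorm0 : enorm (0 : 'rV[R]_d) = 0.
Proof. by rewrite enormE /dot mul0mx mxE sqrtr0. Qed.

Lemma enorm0_eq0 u : enorm u = 0 -> u = 0.
Proof.
move=> u0; have /eqP := sqr_enorm u.
rewrite u0 expr0n/= eq_sym dotE psumr_eq0; last first.
  by move=> i _; rewrite -expr2 sqr_ge0.
move=> /allP ui; apply/rowP => i; rewrite mxE.
have /eqP := ui i (mem_index_enum i); rewrite -expr2 => /eqP.
by rewrite sqrf_eq0 => /eqP.
Qed.

(** Cauchy-Schwarz: the square norm of [enorm v *: u - enorm u *: v] is nonnegative and equals
    [2 * (a * b) * (a * b - c)], with [a], [b] the two norms and [c] the product [dot u v]. *)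
Lemma dot_le u v : dot u v <= enorm u * enorm v.
Proof.
have [u0|u0] := eqVneq (enorm u) 0.
  by rewrite u0 (enorm0_eq0 u0) /dot mul0mx mxE mul0r.
have [v0|v0] := eqVneq (enorm v) 0.
  by rewrite v0 (enorm0_eq0 v0) /dot trmx0 mulmx0 mxE mulr0.
have uv : 0 < enorm u * enorm v by rewrite mulr_gt0// lt0r ?u0 ?v0 enorm_ge0.
have := dotv_ge0 (enorm v *: u - enorm u *: v).
rewrite !(dotBl, dotBr, dotZl, dotZr) -!sqr_enorm (dotC v u).
set a := enorm u in uv *; set b := enorm v in uv *; set c := dot u v => h.
have {}h : 0 <= (a * b) * (a * b - c).
  rewrite -(@pmulr_rge0 _ 2)//; apply: le_trans h _.
  by rewrite le_eqVlt; apply/orP; left; apply/eqP; ring.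
by rewrite -subr_ge0 -(pmulr_rge0 _ uv).
Qed.

Lemma dot_ge u v : - (enorm u * enorm v) <= dot u v.
Proof. by rewrite lerNl -dotNl (le_trans (dot_le _ _))// enormN. Qed.

Lemma enormD u v : enorm (u + v) <= enorm u + enorm v.
Proof.
rewrite -(@ler_pXn2r _ 2)// ?nnegrE ?addr_ge0 ?enorm_ge0//.
rewrite sqrrD !sqr_enorm dotDl !dotDr (dotC v u).
have := dot_le u v; lra.
Qed.

Lemma enormB_ge u v : enorm u - enorm v <= enorm (u - v).
Proof. by rewrite lerBlDr -{1}(subrK v u) enormD. Qed.

Lemma enorm_sum n (F : 'I_n -> 'rV[R]_d) :
  enorm (\sum_j F j) <= \sum_j enorm (F j).
Proof.
apply: (big_ind2 (fun u x => enorm u <= x)) => [|u x v y ux vy|//].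
  by rewrite enorm0.
by rewrite (le_trans (enormD _ _))// lerD.
Qed.

(** Bounds the set in [opnorm] above, so that its [sup] is a true supremum and not a default value.
    Each coordinate of [u *m A] is the product of [u] with a column of [A]; the sum of the column
    norms serves as [M]. *)
Lemma enorm_mulmx_bounded A : exists2 M : R, 0 <= M &
  forall u, enorm (u *m A) <= M * enorm u.
Proof.
exists (\sum_j enorm (row j A^T)).
  by rewrite sumr_ge0// => j _; exact: enorm_ge0.
move=> u.
have coord j : (u *m A) ord0 j = dot u (row j A^T).
  by rewrite dotE mxE; apply: eq_bigr => i _; rewrite !mxE.
have -> : u *m A = \sum_j dot u (row j A^T) *: delta_mx ord0 j.
  by rewrite {1}[u *m A]row_sum_delta; apply: eq_bigr => j _; rewrite coord.
have delta1 j : enorm (delta_mx ord0 j : 'rV[R]_d) = 1.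
  rewrite enormE dotE (bigD1 j)//= big1 ?addr0 ?mxE ?eqxx ?mulr1 ?sqrtr1//.
  move=> i ij.
  by rewrite mxE (negbTE ij) andbF mul0r.
rewrite mulr_suml (le_trans (enorm_sum _))// ler_sum// => j _.
by rewrite enormZ delta1 mulr1 ler_norml mulrC dot_ge dot_le.
Qed.

Lemma enorm_mulmx_le_opnorm A u : enorm (u *m A) <= opnorm A * enorm u.
Proof.
have [M M0 AM] := enorm_mulmx_bounded A.
have [u0|u0] := eqVneq (enorm u) 0.
  by rewrite u0 mulr0 (enorm0_eq0 u0) mul0mx enorm0.
have up : 0 < enorm u by rewrite lt0r u0 enorm_ge0.
rewrite -ler_pdivrMr// mulrC -[X in X * _]ger0_norm ?invr_ge0 ?enorm_ge0//.
rewrite -enormZ scalemxAl; apply: ub_le_sup.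
  exists M => _ [v /= v1 <-]; rewrite (le_trans (AM _))//.
  by rewrite -[leRHS]mulr1 ler_wpM2l.
exists ((enorm u)^-1 *: u) => //=.
by rewrite enormZ ger0_norm ?invr_ge0 ?enorm_ge0// mulVf.
Qed.

Lemma continuous_enorm : continuous (@enorm R d).
Proof.
have sq : continuous (fun u : 'rV[R]_d => \sum_(i < d) u ord0 i ^+ 2).
  apply: continuous_big => [|i _ u]; first exact: add_continuous.
  have ci := @coord_continuous R 1 d ord0 i u.
  exact: (cvgM ci ci).
move=> u; apply: (@continuous_comp _ _ _ _ (@Num.sqrt R)); first exact: sq.
exact: sqrt_continuous.
Qed.

(* The form is nonnegative at [mu a - u] where [a := u A^-1], and
   [mu <a A, a> = mu <u, a> <= |u|^2]. *)
Lemma psd_expanding_lower_bound A (mu : R) : 0 < mu ->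
  (forall u v, dot (u *m A) v = dot (v *m A) u) ->
  (forall u, 0 <= dot (u *m A) u) ->
  (forall u, mu * enorm u <= enorm (u *m A)) ->
  forall u, mu * dot u u <= dot (u *m A) u.
Proof.
move=> mu0 symA psdA expA u.
(* Expansion forces every row of the kernel matrix of [A] to vanish. *)
have Aunit : A \in unitmx.
  rewrite -row_free_unit -kermx_eq0; apply/eqP/row_matrixP => i; rewrite row0.
  apply: enorm0_eq0; apply/eqP; rewrite eq_le enorm_ge0 andbT.
  rewrite -(pmulr_rle0 _ mu0) (le_trans (expA _))//.
  by rewrite -row_mul mulmx_ker row0 enorm0.
pose a := u *m invmx A.
have aA : a *m A = u by rewrite /a mulmxKV.
have aa : mu * dot u a <= dot u u.
  rewrite -sqr_enorm expr2 (le_trans (ler_wpM2l (ltW mu0) (dot_le u a)))//.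
  by rewrite mulrCA ler_wpM2l ?enorm_ge0// -[in leRHS]aA expA.
have := psdA (mu *: a - u).
rewrite mulmxBl -scalemxAl aA !(dotBl, dotBr, dotZl, dotZr) (symA u a) aA.
nra.
Qed.

End InnerProduct.

(** * Derivatives along curves *)

Section ChainRule.
Context {R : realType} {d : nat}.
Implicit Types (f : 'rV[R]_d -> R) (x u v h k : 'rV[R]_d).

Lemma diff_dot_grad f x v : differentiable f x -> 'd f x v = dot v (grad f x).
Proof.
move=> fx; rewrite {1}[v]row_sum_delta linear_sum dotE.
by apply: eq_bigr => i _; rewrite linearZ mxE deriveE.
Qed.

Lemma is_derive_comp_curve (V : normedModType R) (f : 'rV[R]_d -> V)
    (c : R -> 'rV[R]_d) (s : R) v : differentiable f (c s) ->
  is_derive s 1 c v -> is_derive s 1 (f \o c) ('d f (c s) v).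
Proof.
move=> fc [/derivable1_diffP dc cv].
have dfc := differentiable_comp dc fc.
apply: DeriveDef; first exact/derivable1_diffP.
by rewrite deriveE// diff_comp//= -cv deriveE.
Qed.

Lemma is_derive_grad f (c : R -> 'rV[R]_d) (s : R) v :
  differentiable f (c s) -> is_derive s 1 c v ->
  is_derive s 1 (f \o c) (dot v (grad f (c s))).
Proof. by move=> fc cv; rewrite -diff_dot_grad//; exact: is_derive_comp_curve. Qed.

Lemma is_derive_hessian f (c : R -> 'rV[R]_d) (s : R) v :
  differentiable (grad f) (c s) -> is_derive s 1 c v ->
  is_derive s 1 (grad f \o c) (v *m hessian f (c s)).
Proof.
move=> fc cv; rewrite /hessian /jacobian mul_rV_lin1.
exact: is_derive_comp_curve.
Qed.

Lemma is_derive_dotl (c : R -> 'rV[R]_d) (s : R) v k :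
  is_derive s 1 c v -> is_derive s 1 (fun t => dot (c t) k) (dot v k).
Proof.
move=> [dc cv].
have dci i : is_derive s 1 (fun t => c t ord0 i) (v ord0 i).
  apply: DeriveDef; first by move/derivable_mxP : dc; exact.
  by rewrite -cv derive_mx// mxE.
have -> : dot v k = \sum_(i < d) k ord0 i *: v ord0 i.
  by rewrite dotE; apply: eq_bigr => i _; exact: mulrC.
under eq_fun do rewrite dotE.
have -> : (fun t => \sum_i c t ord0 i * k ord0 i) =
    \sum_(i < d) (k ord0 i *: (fun t => c t ord0 i)).
  by apply/funext => t; rewrite fct_sumE; apply: eq_bigr => i _; exact: mulrC.
by apply: is_derive_sum.
Qed.

Lemma is_derive_line x v (s : R) : is_derive s 1 (fun t => x + t *: v) v.
Proof.
have : is_derive s 1 (cst x + (fun t : R => t *: v)) (0 + v).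
  apply: is_deriveD.
  apply: DeriveDef; first exact/derivable1_diffP.
  by rewrite deriveE// diff_val scale1r.
by rewrite add0r.
Qed.

Lemma dot_grad_expansion f x k : differentiable (grad f) x ->
  forall e : R, 0 < e -> \forall y \near (0 : 'rV[R]_d),
  `|dot (grad f (y + x)) k - dot (grad f x) k - dot (y *m hessian f x) k|
    <= e * `|y|.
Proof.
move=> fx e e0.
(* The factor [d * (|k| + 1)] controls the pairing of the remainder with [k] in sup norms; the last
   [+ 1] keeps the divisor positive. *)
have k1 : 0 < d%:R * (`|k| + 1) + 1 :> R.
  by rewrite ltr_wpDl// mulr_ge0// addr_ge0.
have := diff_locally fx; move=> /eqaddoP /(_ (e / (d%:R * (`|k| + 1) + 1))).
rewrite divr_gt0// => /(_ isT); apply: filterS => y /=.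
rewrite -dotBl -dotBl /hessian /jacobian mul_rV_lin1.
rewrite !fctE opprD addrA; set r := (X in `|X|) => ry.
have -> : grad f (y + x) - grad f x - 'd (grad f) x y = r by [].
have : `|dot r k| <= d%:R * (`|k| + 1) * `|r|.
  rewrite dotE (le_trans (ler_norm_sum _ _ _))//.
  apply: (@le_trans _ _ (\sum_(i < d) (`|k| + 1) * `|r|)); last first.
    by rewrite sumr_const card_ord -mulrA mulr_natl.
  have coord (w : 'rV[R]_d) i : `|w ord0 i| <= `|w|.
    rewrite [leRHS]/Num.Def.normr/= mx_normrE.
    by apply: (le_trans _ (le_bigmax _ _ (ord0, i))).
  apply: ler_sum => i _; rewrite normrM mulrC ler_pM// (le_trans (coord k i))//.
  by rewrite lerDl.
move=> /le_trans; apply.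
apply: (@le_trans _ _ ((d%:R * (`|k| + 1) + 1) * `|r|)).
  by rewrite ler_wpM2r// lerDl.
by rewrite mulrC -ler_pdivlMr// mulrAC.
Qed.

End ChainRule.

(** * Second differences and the Hessian *)

Lemma convex_set_line (R : realType) (E : lmodType R) (W : set E) (x y : E)
    (s : R) : convex_set W -> W x -> W y -> 0 <= s <= 1 -> W (x + s *: (y - x)).
Proof.
move=> cW Wx Wy /andP[s0 s1].
have := cW y x (Itv01 s0 s1); rewrite !inE => /(_ Wy Wx).
suff -> : x + s *: (y - x) = s *: y + (1 - s) *: x by [].
by rewrite scalerBr scalerBl scale1r addrCA.
Qed.

Lemma convex_function_midpoint (R : realType) (E : lmodType R) (W : set E)
    (f : E -> R) (x y : E) : convex_function W f -> W x -> W y ->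
  2 * f (2^-1 *: (x + y)) <= f x + f y.
Proof.
move=> cf Wx Wy; have h0 : (0 : R) <= 2^-1 by rewrite invr_ge0.
have h1 : (2^-1 : R) <= 1 by rewrite invf_le1// ler1n.
have := cf (Itv01 h0 h1) x y; rewrite !inE => /(_ Wx Wy).
have half : 1 - 2^-1 = 2^-1 :> R by lra.
have -> : conv (Itv01 h0 h1) (x : convex_lmodType E) y = 2^-1 *: (x + y).
  by rewrite scalerDr; congr (_ + _ *: _); exact: half.
move=> fxy.
have {fxy} : f (2^-1 *: (x + y)) <= 2^-1 * f x + (1 - 2^-1) * f y := fxy.
lra.
Qed.

Lemma MVT_closed (R : realType) (f df : R -> R) (a b : R) : a < b ->
  (forall x, a <= x <= b -> is_derive x 1 f (df x)) ->
  exists2 c, a < c < b & f b - f a = df c * (b - a).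
Proof.
move=> ab fdf; have [||c] := @MVT R f df a b ab.
- by move=> x; rewrite in_itv/= => /andP[ax xb]; apply: fdf; rewrite !ltW.
- by apply: derivable_within_continuous => x; rewrite in_itv/= => /fdf[].
- by rewrite in_itv/= => cab ->; exists c.
Qed.

Section SecondDifferences.
Context {R : realType} {d : nat}.
Variables (f : 'rV[R]_d -> R) (x : 'rV[R]_d).
Hypothesis df : \forall y \near x, differentiable f y.
Hypothesis d2f : differentiable (grad f) x.
Let H := hessian f x.

Definition second_difference (h k : 'rV[R]_d) : R :=
  f (x + h + k) - f (x + h) - f (x + k) + f x.

Lemma second_differenceC h k : second_difference h k = second_difference k h.
Proof. by rewrite /second_difference (addrAC x) (addrAC (f _)). Qed.

(* Mean value theorem for [s |-> f (x + t h + s k) - f (x + s k)], then the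
   expansion of [grad f] at [x]. *)
Lemma second_difference_approx (h k : 'rV[R]_d) (e : R) : 0 < e ->
  \forall t \near 0^'+,
  `|second_difference (t *: h) (t *: k) - t ^+ 2 * dot (h *m H) k| <= e * t ^+ 2.
Proof.
move=> e0.
(* Two gradient expansions are used, each at an increment of norm at most [t * (|h| + |k|)], whence
   the factor 2; the [+ 1] keeps the divisor positive. *)
have M0 : 0 < 2 * (`|h| + `|k|) + 1 by rewrite ltr_wpDl// mulr_ge0// addr_ge0.
have e'0 : 0 < e / (2 * (`|h| + `|k|) + 1) by rewrite divr_gt0.
have /nbhs_norm0P[r r0 rP] := dot_grad_expansion k d2f e'0.
have /nbhs_norm0P[q q0 qP] :
    \forall y \near (0 : 'rV[R]_d), differentiable f (x + y).
  move: df; rewrite (near_shift 0 x) /= subr0; apply: filterS => y /=.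
  by rewrite addrC.
near=> t.
have t0 : 0 < t by near: t; exact: nbhs_right_gt.
have small (y : 'rV[R]_d) : `|y| <= t * (`|h| + `|k|) -> `|y| < r /\ `|y| < q.
  move=> yt; suff [] : t * (`|h| + `|k|) < r /\ t * (`|h| + `|k|) < q.
    by move=> /(le_lt_trans yt) + /(le_lt_trans yt).
  have {yt} : t * (2 * (`|h| + `|k|) + 1) < Num.min r q.
    rewrite -ltr_pdivlMr//; near: t; apply: nbhs_right_lt.
    by rewrite divr_gt0// lt_min r0.
  rewrite lt_min => /andP[].
  split; apply: (le_lt_trans _ (_ : _ < _)); try eassumption.
  - rewrite ler_wpM2l ?ltW//; have := normr_ge0 h; have := normr_ge0 k; lra.
  - rewrite ler_wpM2l ?ltW//; have := normr_ge0 h; have := normr_ge0 k; lra.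
have sk_le s : 0 <= s <= t -> `|s *: k| <= t * (`|h| + `|k|).
  move=> /andP[s0 st]; rewrite normrZ ger0_norm// mulrDr.
  by rewrite ler_wpDl ?mulr_ge0 ?(ltW t0)// ler_wpM2r.
have thsk_le s : 0 <= s <= t -> `|t *: h + s *: k| <= t * (`|h| + `|k|).
  move=> /andP[s0 st]; rewrite (le_trans (ler_normD _ _))// !normrZ.
  by rewrite !ger0_norm ?(ltW t0)// mulrDr lerD2l ler_wpM2r.
pose D s := f (x + t *: h + s *: k) - f (x + s *: k).
pose D' s := dot k (grad f (x + t *: h + s *: k)) - dot k (grad f (x + s *: k)).
have [s|xi xit] := @MVT_closed R D D' 0 t t0.
  move=> st; apply: is_deriveB.
    apply: (@is_derive_grad _ _ f (fun s => x + t *: h + s *: k)).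
      by rewrite -addrA; apply: qP => /=; exact: (small _ (thsk_le _ st)).2.
    exact: is_derive_line.
  apply: (@is_derive_grad _ _ f (fun s => x + s *: k)).
    by apply: qP => /=; exact: (small _ (sk_le _ st)).2.
  exact: is_derive_line.
rewrite subr0 => Dt.
have -> : second_difference (t *: h) (t *: k) = D' xi * t.
  by rewrite -Dt /D /second_difference scale0r !addr0; ring.
have {xit}xit : 0 <= xi <= t by case/andP: xit => /ltW -> /ltW.
have := rP _ (small _ (thsk_le _ xit)).1; have := rP _ (small _ (sk_le _ xit)).1.
rewrite /D' !(dotC k) (addrC _ x) (addrC _ x) (addrA x) => b1 b2.
set e' := e / _ in e'0 b1 b2.
(* Both expansions are centred at [x]; in the difference of their linear terms the [xi *: k] parts
   cancel and only [t *: h] remains. *)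
have B : `|dot (grad f (x + t *: h + xi *: k)) k - dot (grad f (x + xi *: k)) k
    - t * dot (h *m H) k| <= e' * (2 * (t * (`|h| + `|k|))).
  have -> : t * dot (h *m H) k =
      dot ((t *: h + xi *: k) *m H) k - dot ((xi *: k) *m H) k.
    by rewrite -dotBl -mulmxBl addrK -scalemxAl dotZl.
  move: b1 b2; rewrite -/H.
  set a1 := dot (_ *m H) k; set a2 := dot (_ *m H) k.
  set a3 := dot _ k; set a4 := dot _ k; set a5 := dot _ k => b1 b2.
  have -> : a5 - a3 - (a2 - a1) = (a5 - a4 - a2) - (a3 - a4 - a1) by ring.
  rewrite (le_trans (ler_normB _ _))// mulr_natl mulr2n mulrDr.
  rewrite lerD// (le_trans b1, le_trans b2)// ler_wpM2l ?(ltW e'0)//.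
  - exact: thsk_le.
  - exact: sk_le.
have -> : (dot (grad f (x + t *: h + xi *: k)) k
    - dot (grad f (x + xi *: k)) k) * t
   - t ^+ 2 * dot (h *m H) k =
   (dot (grad f (x + t *: h + xi *: k)) k - dot (grad f (x + xi *: k)) k
    - t * dot (h *m H) k) * t by ring.
rewrite normrM (gtr0_norm t0) expr2 mulrA ler_wpM2r ?(ltW t0)//.
rewrite (le_trans B)// /e' -mulrA ler_wpM2l ?(ltW e0)// ler_pdivrMl//.
have := normr_ge0 h; have := normr_ge0 k; nra.
Unshelve. all: by end_near. Qed.

(** The second difference is symmetric in its two increments, and both bilinear values are its limit
    after division by [t ^+ 2]. *)
Lemma hessian_sym h k : dot (h *m H) k = dot (k *m H) h.
Proof.
apply/eqP; rewrite -subr_eq0 -normr_le0.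
apply/ler_addgt0Pr => e e0; rewrite add0r.
have e20 : 0 < e / 2 by rewrite divr_gt0.
near (0 : R)^'+ => t.
have t0 : 0 < t by near: t; exact: nbhs_right_gt.
have b1 : `|second_difference (t *: h) (t *: k) - t ^+ 2 * dot (h *m H) k|
  <= e / 2 * t ^+ 2 by near: t; exact: second_difference_approx.
have b2 : `|second_difference (t *: k) (t *: h) - t ^+ 2 * dot (k *m H) h|
  <= e / 2 * t ^+ 2 by near: t; exact: second_difference_approx.
have t20 : 0 < t ^+ 2 by rewrite exprn_gt0.
rewrite second_differenceC in b1.
rewrite -(ler_pM2r t20) -[in leLHS](gtr0_norm t20) -normrM.
rewrite (splitr e) [leRHS]mulrDl (le_trans _ (lerD b2 b1))//.
rewrite (le_trans _ (ler_normB _ _))//; rewrite le_eqVlt; apply/orP; left.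
by apply/eqP; congr `|_|; ring.
Unshelve. all: by end_near. Qed.

(** Midpoint convexity between [x] and [x + 2 t h] makes the second difference nonnegative. Were the
    form negative, an error of half its size would leave the second difference negative for small
    [t]. *)
Lemma hessian_psd (W : set 'rV[R]_d) h : W° x -> convex_function W f ->
  0 <= dot (h *m H) h.
Proof.
move=> Wx cf; rewrite leNgt; apply/negP => Hh.
have /(second_difference_approx h h) Hs : 0 < - dot (h *m H) h / 2.
  by rewrite divr_gt0// oppr_gt0.
have /nbhs_norm0P[q q0 qP] : \forall y \near (0 : 'rV[R]_d), W (x + y).
  have : \forall y \near x, W y := Wx.
  rewrite (near_shift 0 x) /= subr0.
  by apply: filterS => y /=; rewrite addrC.
near (0 : R)^'+ => t.
have t0 : 0 < t by near: t; exact: nbhs_right_gt.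
have tq : `|t *: h + t *: h| < q.
  rewrite -scalerDr normrZ gtr0_norm//.
  apply: (@le_lt_trans _ _ (t * (`|h + h| + 1))).
    by rewrite ler_wpM2l ?(ltW t0)// lerDl.
  rewrite -ltr_pdivlMr ?ltr_wpDl//; near: t; apply: nbhs_right_lt.
  by rewrite divr_gt0// ltr_wpDl.
have Wx2 : W (x + t *: h + t *: h) by rewrite -addrA; exact: qP.
have Wx0 : W x by exact: interior_subset Wx.
have : t ^+ 2 * dot (h *m H) h < - (- dot (h *m H) h / 2 * t ^+ 2).
  rewrite -mulNr [ltLHS]mulrC ltr_pM2r ?exprn_gt0//; lra.
have : 0 <= second_difference (t *: h) (t *: h).
  have := convex_function_midpoint cf Wx0 Wx2.
  suff -> : 2^-1 *: (x + (x + t *: h + t *: h)) = x + t *: h.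
    rewrite /second_difference; lra.
  have -> : x + (x + t *: h + t *: h) = 2 *: (x + t *: h).
    by rewrite scaler_nat mulr2n addrACA -!addrA.
  by rewrite scalerA mulVf// scale1r.
have : `|second_difference (t *: h) (t *: h) - t ^+ 2 * dot (h *m H) h| <=
  - dot (h *m H) h / 2 * t ^+ 2 by near: t.
rewrite ler_norml => /andP[_]; lra.
Unshelve. all: by end_near. Qed.
End SecondDifferences.

(** * Hessian bounds on the domain *)

(** Limit [s -> 0] in a bound with linear error; it carries Hessian bounds from the interior of [W]
    to all of [W]. *)
Lemma ler_add_small (R : realFieldType) (a b c : R) :
  (forall s, 0 < s <= 1 -> a <= b + s * c) -> a <= b.
Proof.
move=> h; apply/ler_addgt0Pr => e e0.
have c0 : 0 < `|c| + 1 by rewrite ltr_wpDl.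
have s0 : 0 < Num.min 1 (e / (`|c| + 1)) by rewrite lt_min ltr01 divr_gt0.
have := h (Num.min 1 (e / (`|c| + 1))); rewrite s0 ge_min lexx => /(_ isT).
move=> /le_trans; apply; rewrite lerD2l.
apply: (@le_trans _ _ (Num.min 1 (e / (`|c| + 1)) * (`|c| + 1))).
  by rewrite ler_wpM2l ?(ltW s0)// (le_trans (ler_norm c))// lerDl.
by rewrite -ler_pdivlMr// ge_min lexx orbT.
Qed.

(** The homothety of centre [x] and ratio [s] maps a ball of radius [r] around [x0] inside [W] onto
    a ball of radius [s * r] around the new point, and convexity keeps the image in [W]. *)
Lemma convex_set_interior (R : realType) (V : normedModType R) (W : set V)
    (x x0 : V) (s : R) : convex_set W -> W x -> W° x0 -> 0 < s <= 1 ->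
  W° (x + s *: (x0 - x)).
Proof.
move=> cW Wx Wx0 /andP[s0 s1].
have /nbhs_normP[r /= r0 rW] : nbhs x0 W := Wx0.
apply/nbhs_normP; exists (s * r); first by rewrite /= mulr_gt0.
move=> y /= yr; pose z := x + s^-1 *: (y - x).
have -> : y = x + s *: (z - x).
  rewrite /z addrAC subrr add0r scalerA mulfV ?gt_eqF// scale1r.
  by rewrite addrCA subrr addr0.
apply: convex_set_line => //; last by rewrite ltW.
apply: rW => /=.
have -> : x0 - z = s^-1 *: (x + s *: (x0 - x) - y).
  rewrite /z scalerBr [in RHS]scalerBr scalerDr scalerA mulVf ?gt_eqF// scale1r.
  by rewrite opprD opprB addrA [s^-1 *: x + (x0 - x)]addrC addrA.
by rewrite normrZ gtr0_norm ?invr_gt0// ltr_pdivrMl.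
Qed.

Lemma enorm_mulmx_perturb (R : realType) (d : nat) (A B : 'M[R]_d)
    (h : 'rV[R]_d) (b e : R) :
  enorm (h *m B) <= b -> enorm (h *m (A - B)) <= e -> enorm (h *m A) <= b + e.
Proof.
move=> hB hAB; have -> : h *m A = h *m B + h *m (A - B).
  by rewrite -mulmxDr addrC subrK.
by rewrite (le_trans (enormD _ _))// lerD.
Qed.

Lemma dot_mulmx_perturb (R : realType) (d : nat) (A B : 'M[R]_d)
    (h : 'rV[R]_d) (b e : R) :
  b <= dot (h *m B) h -> enorm (h *m (A - B)) <= e ->
  b <= dot (h *m A) h + e * enorm h.
Proof.
move=> hB hAB; have -> : h *m A = h *m B + h *m (A - B).
  by rewrite -mulmxDr addrC subrK.
have := dot_ge (h *m (A - B)) h; have := ler_wpM2r (enorm_ge0 h) hAB.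
rewrite dotDl; lra.
Qed.

Section HessianBounds.
Context {R : realType} {d : nat}.
Variables (W : set 'rV[R]_d) (G beta rho mu : R) (f : 'rV[R]_d -> R).
Hypotheses (cW : convex_set W) (W0 : W° !=set0) (mu0 : 0 < mu).
Hypothesis fA : assumptions12 G beta rho mu W f.
Implicit Types (x h : 'rV[R]_d).

Lemma differentiable_on x : W x ->
  (\forall y \near x, differentiable f y) /\ differentiable (grad f) x.
Proof.
move=> Wx; case: fA => [[B [oB WB dB]] _ _].
split; last by have [] := dB _ (WB _ Wx).
by apply: filterS (open_nbhs_nbhs (conj oB (WB _ Wx))) => y /dB[].
Qed.

Lemma enorm_grad_quotient_cvg x h : W x ->
  enorm (t^-1 *: (grad f (t *: h + x) - grad f x)) @[t --> 0^'] -->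
    enorm (h *m hessian f x).
Proof.
move=> Wx; have [_ dg] := differentiable_on Wx.
apply: continuous_cvg; first exact: continuous_enorm.
rewrite -deriveEjacobian//; exact: (diff_derivable dg).
Qed.

Lemma interior_line_near x h : W° x -> \forall t \near (0 : R)^', W (t *: h + x).
Proof.
move=> Wx; have c : (fun t : R => t *: h + x) t @[t --> 0] --> 0 *: h + x.
  by apply: cvgD; [exact: scalel_continuous|exact: cvg_cst].
by apply: nbhs_dnbhs; apply: c; rewrite scale0r add0r.
Qed.

(** From an interior point, short steps in any direction stay in [W], so both bounds on gradient
    differences apply to difference quotients and pass to the limit. *)
Lemma enorm_mulmx_hessian_interior x h : W° x ->
  mu * enorm h <= enorm (h *m hessian f x) <= beta * enorm h.
Proof.
move=> Wx; have Wx' := interior_subset Wx.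
case: fA => [_ f1 [_ f2]]; apply/andP; split.
- apply: (cvgr_to_ge (enorm_grad_quotient_cvg Wx')).
  near=> t.
  have t0 : t != 0 by near: t; exact: nbhs_dnbhs_neq.
  have Wt : W (t *: h + x) by near: t; exact: interior_line_near.
  rewrite enormZ normfV ler_pdivlMl ?normr_gt0//.
  have := f2 _ _ Wt Wx'; rewrite addrK enormZ; lra.
- apply: (cvgr_to_le (enorm_grad_quotient_cvg Wx')).
  near=> t.
  have t0 : t != 0 by near: t; exact: nbhs_dnbhs_neq.
  have Wt : W (t *: h + x) by near: t; exact: interior_line_near.
  rewrite enormZ normfV ler_pdivrMl ?normr_gt0//.
  have [_ + _] := f1 _ _ Wt Wx'; rewrite addrK enormZ; lra.
Unshelve. all: by end_near. Qed.

Lemma hessian_lower_bound_interior x h : W° x ->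
  mu * dot h h <= dot (h *m hessian f x) h.
Proof.
move=> Wx; have [df dg] := differentiable_on (interior_subset Wx).
apply: psd_expanding_lower_bound => // [u v|u|u].
- exact: hessian_sym.
- by apply: hessian_psd Wx _ => //; case: fA => [_ _ []].
- by case/andP: (enorm_mulmx_hessian_interior u Wx).
Qed.

Lemma enorm_hessianB x y h : W x -> W y ->
  enorm (h *m (hessian f x - hessian f y)) <= rho * enorm (x - y) * enorm h.
Proof.
move=> Wx Wy; case: fA => [_ /(_ _ _ Wx Wy)[_ _ fH] _].
by rewrite (le_trans (enorm_mulmx_le_opnorm _ _))// ler_wpM2r// enorm_ge0.
Qed.

(** The approximating point lies on the segment from [x] to a fixed interior point. [M] depends
    neither on [s] nor on [h], as the passage to the limit requires. *)
Lemma interior_approximation x : W x -> exists M : R,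
  forall s, 0 < s <= 1 -> exists2 y, W° y &
    forall h, enorm (h *m (hessian f x - hessian f y)) <= s * M * enorm h.
Proof.
move=> Wx; have [x0 Wx0] := W0; exists (rho * enorm (x0 - x)).
move=> s s01; have s0 : 0 < s by case/andP: s01.
have Ws := convex_set_interior cW Wx Wx0 s01.
exists (x + s *: (x0 - x)) => // h.
apply: le_trans (enorm_hessianB h Wx (interior_subset Ws)) _.
have -> : x - (x + s *: (x0 - x)) = - (s *: (x0 - x)).
  by rewrite opprD addrA subrr add0r.
rewrite enormN enormZ (gtr0_norm s0) ler_wpM2r ?enorm_ge0// mulrCA.
by [].
Qed.

Lemma enorm_mulmx_hessian x h : W x ->
  enorm (h *m hessian f x) <= beta * enorm h.
Proof.
move=> /interior_approximation[M approx].
apply: (@ler_add_small _ _ _ (M * enorm h)) => s /approx[y Wy xy].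
have /andP[_ b] := enorm_mulmx_hessian_interior h Wy.
by rewrite mulrA; exact: enorm_mulmx_perturb b (xy h).
Qed.

Lemma hessian_lower_bound x h : W x ->
  mu * dot h h <= dot (h *m hessian f x) h.
Proof.
move=> /interior_approximation[M approx].
apply: (@ler_add_small _ _ _ (M * enorm h * enorm h)) => s /approx[y Wy xy].
rewrite 2!mulrA.
exact: dot_mulmx_perturb (hessian_lower_bound_interior h Wy) (xy h).
Qed.

End HessianBounds.

(* If the inequality fails, [phi] minus the parabola of slightly smaller
   curvature through its end points has an interior maximum, immediately to the
   right of which its derivative would be positive.  Only a one-sided growth of
   [dphi] is assumed because [dphi] need not be differentiable. *)
Lemma strong_convexity_midpoint (R : realType) (phi dphi : R -> R) (c : R) :
  (forall s : R, 0 <= s <= 1 -> is_derive s 1 phi (dphi s)) ->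
  (forall p : R, 0 < p < 1 -> forall e : R, 0 < e ->
    \forall s \near p^'+, (c - e) * (s - p) <= dphi s - dphi p) ->
  2 * phi 2^-1 + c / 4 <= phi 0 + phi 1.
Proof.
move=> dphiP growth; rewrite leNgt; apply/negP => gap.
pose e := 2 * phi 2^-1 + c / 4 - (phi 0 + phi 1).
have e0 : 0 < e by rewrite subr_gt0.
(* The slope [l] makes [psi] vanish at both 0 and 1, while [psi 2^-1] equals [3 / 8 * e]; the
   maximum is thus positive and attained strictly inside. *)
pose b := c - e; pose l := phi 1 - phi 0 - b / 2.
pose psi (s : R) := phi s - phi 0 - l * s - b / 2 * s ^+ 2.
pose dpsi (s : R) := dphi s - l - b * s.
have dpsiP (s : R) : 0 <= s <= 1 -> is_derive s 1 psi (dpsi s).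
  move=> s01; have := dphiP s s01 => ds.
  have dq : is_derive s 1 ((b / 2) *: ((id : R -> R) ^+ 2)) (b * s).
    by apply: is_derive_eq; rewrite /GRing.scale/= expr1; field.
  have dl : is_derive s 1 (l *: (id : R -> R)) l.
    by apply: is_derive_eq; rewrite /GRing.scale/= mulr1.
  have dc : is_derive s 1 (phi - cst (phi 0)) (dphi s).
    by apply: is_derive_eq; rewrite subr0.
  exact: is_deriveB (is_deriveB dc dl) dq.
have [p p01 pmax] : exists2 p, 0 < p < 1 &
    forall s : R, 0 <= s <= 1 -> psi s <= psi p.
  have [||p + pmax] := @EVT_max R psi 0 1.
  - exact: ler01.
  - by apply: derivable_within_continuous => s; rewrite in_itv/= => /dpsiP[].
  rewrite in_itv/= => /andP[p0 p1].
  have {}pmax (s : R) : 0 <= s <= 1 -> psi s <= psi p.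
    by move=> s01; apply: pmax; rewrite in_itv.
  have psih : 0 < psi 2^-1.
    rewrite /psi /l /b; move: gap; rewrite /e; lra.
  have psip : 0 < psi p.
    apply: lt_le_trans psih _; apply: pmax.
    by rewrite invr_ge0 ler0n invf_le1// ler1n.
  exists p => //; rewrite !lt_neqAle p0 p1 !andbT; apply/andP; split.
  - apply/eqP => p00; move: psip; rewrite -p00 /psi; lra.
  - by apply/eqP => p10; move: psip; rewrite p10 /psi /l; lra.
have dp0 : dpsi p = 0.
  have : is_derive p 1 psi 0.
    apply: (@derive1_at_max R psi 0 1); rewrite ?ler01 ?in_itv//.
    - move=> t; rewrite in_itv/= => /andP[/ltW t0 /ltW t1].
      by have [] := dpsiP t; rewrite ?t0.
    - move=> t; rewrite in_itv/= => /andP[/ltW t0 /ltW t1].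
      by apply: pmax; rewrite t0.
  move=> [_ <-]; have /andP[/ltW p0 /ltW p1] := p01.
  by have [|_ ->] := dpsiP p; rewrite ?p0.
(* With growth error [e / 2] against the curvature [c - e] of the parabola, [dpsi] still grows at
   rate at least [e / 2] to the right of its zero [p]. *)
have e20 : 0 < e / 2 by rewrite divr_gt0.
have /nbhs_normP[r /= r0 rP] : \forall s \near p, p < s ->
  (c - e / 2) * (s - p) <= dphi s - dphi p by exact: growth p p01 _ e20.
have /andP[p0 p1] := p01.
(* The point [q] stays both in [[0, 1]] and within reach of the growth bound; the mean value theorem
   on [[p, q]] then gives [psi q > psi p], against maximality. *)
pose q := Num.min (p + r) 1.
have pq : p < q by rewrite lt_min p1 ltrDl r0.
have q1 : q <= 1 by rewrite ge_min lexx orbT.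
have [s sq|xi /andP[pxi xiq] psiq] := @MVT_closed R psi dpsi p q pq.
  apply: dpsiP; have /andP[ps sq'] := sq.
  by rewrite (le_trans (ltW p0))// (le_trans sq').
have : psi q <= psi p by apply: pmax; rewrite q1 (le_trans (ltW p0))// ltW.
rewrite leNgt => /negP; apply; rewrite -subr_gt0 psiq mulr_gt0 ?subr_gt0//.
have xir : `|p - xi| < r.
  rewrite distrC gtr0_norm ?subr_gt0// ltrBlDl (lt_le_trans xiq)//.
  by rewrite ge_min lexx.
have := rP _ xir pxi.
have : 0 < e / 2 * (xi - p) by rewrite mulr_gt0// subr_gt0.
move: dp0; rewrite /dpsi /b; lra.
Qed.

(** * The loss after one update *)

Lemma is_derive_growth (R : realType) (k : R -> R) (p l e : R) :
  is_derive p 1 k l -> 0 < e ->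
  \forall s \near p^'+, (l - e) * (s - p) <= k s - k p.
Proof.
move=> [/derivable1_diffP dk kl] e0.
have := diff_locally dk; move=> /eqaddoP /(_ e e0) near0.
have : \forall s \near p, p < s -> (l - e) * (s - p) <= k s - k p.
  rewrite (near_shift 0 p) /= subr0; apply: filterS near0 => h /= kh.
  rewrite ltrDr => h0; rewrite addrK; move: kh.
  have -> : (k \o shift p - (cst (k p) + 'd k p)) h = k (h + p) - (k p + h * l).
    have dkh : 'd k p (h *: 1) = h *: 'd k p 1 by rewrite linearZ.
    rewrite [h *: 1]mulr1 in dkh.
    by rewrite -kl deriveE// !fctE dkh.
  rewrite (gtr0_norm h0) ler_norml => /andP[+ _]; lra.
by [].
Qed.

Lemma sub_id_scale_mulmx (R : realType) (d : nat) (A B : 'M[R]_d)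
    (v : 'rV[R]_d) (a : R) :
  (v - a *: (v *m A)) - (v - a *: (v *m B)) = - a *: (v *m (A - B)).
Proof.
by rewrite mulmxBr scaleNr scalerBr !opprB addrC addrA subrK.
Qed.

Lemma dot_sub_split (R : realType) (d : nat) (u w a b : 'rV[R]_d) :
  dot u a - dot w b = (dot a w - dot b w) + dot (u - w) a.
Proof. rewrite dotBl !(dotC _ w); ring. Qed.

Section MetaLoss.
Context {R : realType} {d : nat}.
Variables (W : set 'rV[R]_d) (G beta rho mu alpha : R).
Variables (f fhat : 'rV[R]_d -> R).
Hypotheses (cW : convex_set W) (W0 : W° !=set0).
Hypothesis mu0 : 0 < mu.
Hypotheses (fA : assumptions12 G beta rho mu W f).
Hypotheses (fhatA : assumptions12 G beta rho mu W fhat).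
Hypotheses (alpha0 : 0 < alpha) (alpha_beta : alpha * beta <= 1 / 2).
Hypothesis alpha_rho : alpha * (rho * G) <= mu / 8.
Let U := update alpha fhat.
Hypothesis UW : forall u, W u -> W (U u).
Implicit Types (x y v : 'rV[R]_d).

Lemma enorm_grad_le x : W x -> enorm (grad f x) <= G.
Proof. by move=> Wx; case: fA => [_ f1 _]; have [] := f1 x x Wx Wx. Qed.

(** The differential of [U] at [x] applied to [v]. *)
Definition update_diff x v := v - alpha *: (v *m hessian fhat x).

Lemma update_diffB x y v : update_diff x v - update_diff y v =
  - alpha *: (v *m (hessian fhat x - hessian fhat y)).
Proof. exact: sub_id_scale_mulmx. Qed.

(** The correction has norm at most [alpha * beta * enorm v], hence at most half of [enorm v]; the
    upper factor 3/2 is relaxed to 2. *)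
Lemma enorm_update_diff x v : W x ->
  enorm v / 2 <= enorm (update_diff x v) <= 2 * enorm v.
Proof.
move=> Wx; have := enorm_mulmx_hessian cW W0 fhatA v Wx.
rewrite /update_diff; move: (v *m _) => w wv.
have aw : enorm (alpha *: w) <= enorm v / 2.
  rewrite enormZ gtr0_norm// (le_trans (ler_wpM2l (ltW alpha0) wv))//.
  by rewrite mulrA mulrC ler_wpM2l ?enorm_ge0// -div1r.
have := enormB_ge v (alpha *: w); have := enormD v (- (alpha *: w)).
rewrite enormN; have := enorm_ge0 v; lra.
Qed.

Lemma is_derive_update (c : R -> 'rV[R]_d) (s : R) v : W (c s) ->
  is_derive s 1 c v -> is_derive s 1 (U \o c) (update_diff (c s) v).
Proof.
move=> Ws dc; have [_ dg] := differentiable_on fhatA Ws.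
exact: is_deriveB dc (is_deriveZ alpha (is_derive_hessian dg dc)).
Qed.

Section Segment.
Variables (x y : 'rV[R]_d).
Hypotheses (Wx : W x) (Wy : W y).
Let v := y - x.
Let c (s : R) := x + s *: v.

Let Wc (s : R) : 0 <= s <= 1 -> W (c s).
Proof. exact: convex_set_line. Qed.

Let c0 : c 0 = x.
Proof. by rewrite /c scale0r addr0. Qed.

Let c1 : c 1 = y.
Proof. by rewrite /c scale1r /v addrC subrK. Qed.

Let dphi (s : R) := dot (update_diff (c s) v) (grad f (U (c s))).

Lemma is_derive_segment (s : R) : 0 <= s <= 1 ->
  is_derive s 1 (f \o (U \o c)) (dphi s).
Proof.
move=> s01; have Ws := Wc s01.
apply: (@is_derive_grad _ _ f (U \o c)).
  have [near_diff _] := differentiable_on fA (UW Ws).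
  exact: (nbhs_singleton near_diff).
by apply: is_derive_update => //; exact: is_derive_line.
Qed.

Lemma meta_loss_lipschitz : f (U y) - f (U x) <= 2 * G * enorm (y - x).
Proof.
have [s /andP[/ltW s0 /ltW s1] ] := MVT_closed ltr01 is_derive_segment.
rewrite /= c0 c1 subr0 mulr1 => ->.
rewrite /dphi (le_trans (dot_le _ _))//.
have Ws : W (c s) by apply: Wc; rewrite s0.
have /andP[_ Mv] := enorm_update_diff v Ws.
have gG := enorm_grad_le (UW Ws).
by rewrite mulrAC ler_pM// enorm_ge0.
Qed.

Lemma dphi_growth (p : R) : 0 < p < 1 -> forall e : R, 0 < e ->
  \forall s \near p^'+, (mu / 8 * enorm v ^+ 2 - e) * (s - p) <= dphi s - dphi p.
Proof.
move=> /andP[p0 p1] e e0; have p01 : 0 <= p <= 1 by rewrite !ltW.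
have Wp := Wc p01.
pose w := update_diff (c p) v.
have [_ dg] := differentiable_on fA (UW Wp).
(* Only the gradient moves here: the derivative is the Hessian form at [w], and
   [enorm w >= enorm v / 2] turns [mu] into [mu / 4]. *)
have [a dk curv] : exists2 a, is_derive p 1 (fun s => dot (grad f (U (c s))) w) a
    & mu / 4 * enorm v ^+ 2 <= a.
  exists (dot (w *m hessian f (U (c p))) w).
    apply: is_derive_dotl; apply: (@is_derive_hessian _ _ f (U \o c)) => //.
    by apply: is_derive_update => //; exact: is_derive_line.
  apply: le_trans (hessian_lower_bound cW W0 mu0 fA w (UW Wp)).
  rewrite -sqr_enorm -mulrA ler_wpM2l ?(ltW mu0)//.
  have /andP[vw _] := enorm_update_diff v Wp.
  have := @ler_pM _ _ _ _ _ _ _ vw vw; rewrite -expr2.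
  rewrite divr_ge0 ?enorm_ge0// => /(_ isT isT); lra.
near=> s.
have ps : p < s by near: s; exact: nbhs_right_gt.
have s1 : s < 1 by near: s; exact: nbhs_right_lt.
have s01 : 0 <= s <= 1 by rewrite (ltW s1) (ltW (lt_trans p0 ps)).
have Ws := Wc s01.
have ks : (a - e) * (s - p) <=
    dot (grad f (U (c s))) w - dot (grad f (U (c p))) w.
  by near: s; exact: is_derive_growth.
rewrite /dphi dot_sub_split -/w update_diffB dotZl.
have sp : 0 < s - p by rewrite subr_gt0.
(* The Hessian of [fhat] varies by at most [rho * (s - p) * enorm v], so this cost is linear in
   [s - p]; [alpha_rho] caps it at half of the available curvature. *)
have pert : alpha * dot (v *m (hessian fhat (c s) - hessian fhat (c p)))
      (grad f (U (c s)))
    <= mu / 8 * enorm v ^+ 2 * (s - p).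
  have := enorm_hessianB fhatA v Ws Wp.
  have -> : c s - c p = (s - p) *: v.
    by rewrite /c opprD addrACA subrr add0r scalerBl.
  rewrite enormZ (gtr0_norm sp) => hB.
  have gG := enorm_grad_le (UW Ws).
  apply: (@le_trans _ _ (alpha * (rho * ((s - p) * enorm v) * enorm v * G))).
    rewrite ler_wpM2l ?(ltW alpha0)// (le_trans (dot_le _ _))//.
    by rewrite ler_pM// enorm_ge0.
  have -> : alpha * (rho * ((s - p) * enorm v) * enorm v * G) =
    alpha * (rho * G) * enorm v ^+ 2 * (s - p) by ring.
  by rewrite !ler_wpM2r ?(ltW sp)// sqr_ge0.
rewrite mulNr; apply: le_trans (lerB ks pert).
rewrite -mulrBl ler_wpM2r ?(ltW sp)//; clear ks pert; lra.
Unshelve. all: by end_near. Qed.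

(** The curvature along the segment is [mu / 8 * enorm v ^+ 2], and the midpoint inequality retains
    a quarter of it. *)
Lemma meta_loss_midpoint :
  2 * f (U (2^-1 *: (x + y))) + mu / 32 * enorm (y - x) ^+ 2 <=
  f (U x) + f (U y).
Proof.
have := strong_convexity_midpoint is_derive_segment dphi_growth.
rewrite /= c0 c1.
have -> : c 2^-1 = 2^-1 *: (x + y).
  rewrite /c /v scalerBr scalerDr addrCA [RHS]addrC; congr (_ + _).
  by rewrite -{1}[x]scale1r -scalerBl; congr (_ *: _); lra.
lra.
Qed.

End Segment.
End MetaLoss.

(** * Regret of follow the leader *)

Section FollowTheLeader.
Context {R : realType} {d : nat}.
Variables (W : set 'rV[R]_d) (F : nat -> 'rV[R]_d -> R) (w : nat -> 'rV[R]_d).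
Variables (L m : R).
Hypotheses (cW : convex_set W) (L0 : 0 <= L) (m0 : 0 < m).
Hypothesis lipF : forall t, (1 <= t)%N -> forall x y, W x -> W y ->
  F t y - F t x <= L * enorm (y - x).
Hypothesis midF : forall t, (1 <= t)%N -> forall x y, W x -> W y ->
  2 * F t (2^-1 *: (x + y)) + m * enorm (y - x) ^+ 2 <= F t x + F t y.
Let S (t : nat) u := \sum_(1 <= k < t.+1) F k u.
Hypothesis w1 : W (w 1%N).
Hypothesis leader : forall t, (1 <= t)%N -> argmin W (S t) (w t.+1).

Let recS t u : S t.+1 u = S t u + F t.+1 u.
Proof. exact: big_nat_recr. Qed.

Lemma leader_in t : (1 <= t)%N -> W (w t).
Proof. by case: t => [//|[//|t] _]; have [] := @leader t.+1 isT. Qed.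

(** Induction on [T]: the hypothesis is applied with the newest leader as comparator, and its
    minimality then allows any [u]. *)
Lemma be_the_leader T u : W u -> \sum_(1 <= t < T.+1) F t (w t.+1) <= S T u.
Proof.
elim: T u => [|T IH] u Wu; first by rewrite /S !big_geq.
have [WT minT] := @leader T.+1 isT.
rewrite big_nat_recr//= (le_trans _ (minT _ Wu))// recS lerD2r; exact: IH.
Qed.

Lemma cumulative_midpoint t x y : W x -> W y ->
  2 * S t (2^-1 *: (x + y)) + t%:R * m * enorm (y - x) ^+ 2 <= S t x + S t y.
Proof.
move=> Wx Wy; elim: t => [|t IH].
  by rewrite /S !big_geq// mulr0 !mul0r !addr0.
rewrite !recS -natr1; have := @midF t.+1 isT _ _ Wx Wy; lra.
Qed.

(** With [e] the distance between consecutive plays and [D] the left side, curvature gives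
    [t * m * e ^+ 2 <= D] and the Lipschitz bound gives [D <= L * e]; hence [e <= L / (t * m)]. *)
Lemma leader_drift t : (1 <= t)%N ->
  F t (w t) - F t (w t.+1) <= L ^+ 2 / m * t%:R^-1.
Proof.
case: t => [//|t] _.
have [Wt1 mint1] := @leader t.+1 isT.
have Wt := @leader_in t.+1 isT.
have mid : W (2^-1 *: (w t.+2 + w t.+1)).
  have h01 : 0 <= (2^-1 : R) <= 1 by rewrite invr_ge0 ler0n invf_le1// ler1n.
  have := convex_set_line cW Wt1 Wt h01; congr W.
  rewrite scalerBr scalerDr addrCA [RHS]addrC; congr (_ + _).
  by rewrite -{1}[w t.+2]scale1r -scalerBl; congr (_ *: _); lra.
(* The new leader does no worse than the midpoint, so the cumulative loss exceeds its minimum at the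
   old play by the curvature term. The old play is optimal for the earlier rounds, which leaves only
   the last loss. *)
have drift : t.+1%:R * m * enorm (w t.+1 - w t.+2) ^+ 2 <=
    F t.+1 (w t.+1) - F t.+1 (w t.+2).
  have := cumulative_midpoint t.+1 Wt1 Wt; have := mint1 _ mid.
  have : S t (w t.+1) <= S t (w t.+2).
    (* In the first round the play is arbitrary, but the earlier sum is empty. *)
    case: t {Wt1 mint1 mid} Wt => [|t] Wt; first by rewrite /S !big_geq.
    have [_] := @leader t.+1 isT; apply.
    exact: (@leader_in t.+3).
  rewrite !recS; lra.
have := @lipF t.+1 isT _ _ Wt1 Wt; move: drift.
set D := F _ _ - F _ _; have := enorm_ge0 (w t.+1 - w t.+2).
set e := enorm _ => e0 drift lip.
have tm0 : 0 < t.+1%:R * m by rewrite mulr_gt0// ltr0n.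
have [e_eq0|e_neq0] := eqVneq e 0.
  rewrite (le_trans lip)// e_eq0 mulr0 mulr_ge0 ?invr_ge0 ?ler0n//.
  by rewrite divr_ge0 ?sqr_ge0// ltW.
have {}e0 : 0 < e by rewrite lt0r e_neq0.
have eL : t.+1%:R * m * e <= L.
  by have := le_trans drift lip; rewrite expr2 mulrA ler_pM2r.
rewrite -mulrA -invfM [m * _]mulrC (le_trans lip)// expr2 -mulrA ler_wpM2l//.
by rewrite ler_pdivlMr// [leLHS]mulrC.
Qed.

Lemma ftl_regret T u : W u ->
  \sum_(1 <= t < T.+1) F t (w t) - S T u <=
  L ^+ 2 / m * \sum_(1 <= t < T.+1) t%:R^-1.
Proof.
move=> Wu; rewrite (le_trans (lerB (lexx _) (be_the_leader T Wu)))//.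
rewrite -sumrB mulr_sumr; apply: ler_sum_nat => t /andP[t1 _].
exact: leader_drift.
Qed.

End FollowTheLeader.

(** * Logarithmic growth of the harmonic sum, and the final constant *)

Lemma ln_succ_ge (R : realType) (n : nat) : (1 <= n)%N ->
  n.+1%:R^-1 <= ln (n.+1%:R) - ln (n%:R) :> R.
Proof.
move=> n1; have n0 : 0 < n%:R :> R by rewrite ltr0n.
have sn0 : 0 < n.+1%:R :> R by rewrite ltr0n.
have nE : n%:R / n.+1%:R = 1 + - n.+1%:R^-1 :> R.
  by rewrite -natr1; field; rewrite natr1 gt_eqF.
have : ln (1 + - n.+1%:R^-1) <= - n.+1%:R^-1 :> R.
  by apply: le_ln1Dx; rewrite ltrN2 invf_lt1// ltr1n ltnS.
by rewrite -nE ln_div ?posrE// lerNr opprB.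
Qed.

(** The induction starts at [T = 2], where [ln 2 >= 1 / 2] gives [1 + 1 / 2 <= 3 * ln 2]; this fixes
    the factor 3. Each further term is at most an increment of [ln]. *)
Lemma harmonic_le_ln (R : realType) (T : nat) : (2 <= T)%N ->
  \sum_(1 <= t < T.+1) t%:R^-1 <= 3 * ln T%:R :> R.
Proof.
elim: T => [//|[//|[_ _|T IH _]]].
  have := @ln_succ_ge R 1 isT; rewrite ln1 subr0 => ln2.
  rewrite big_nat_recl// big_nat1 /= invr1; lra.
rewrite big_nat_recr//=.
have := IH isT; have := @ln_succ_ge R T.+2 isT.
have : 0 <= T.+3%:R^-1 :> R by rewrite invr_ge0.
move: (ln T.+3%:R) (ln T.+2%:R) (T.+3%:R^-1) => a b c; lra.
Qed.

Theorem corollary2 (R : realType) :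
  exists C : R, 0 < C /\
  forall (d : nat) (W : set 'rV[R]_d) (G beta rho mu alpha : R)
    (f fhat : nat -> 'rV[R]_d -> R) (w : nat -> 'rV[R]_d),
    (1 <= d)%N ->
    convex_set W -> W° !=set0 ->
    0 < G -> 0 < beta -> 0 < rho -> 0 < mu ->
    (forall t, (1 <= t)%N ->
      assumptions12 G beta rho mu W (f t) /\
      assumptions12 G beta rho mu W (fhat t)) ->
    0 < alpha ->
    alpha <= Num.min (1 / (2 * beta)) (mu / (8 * rho * G)) ->
    (forall t, (1 <= t)%N -> forall u, W u -> W (update alpha (fhat t) u)) ->
    FTML alpha f fhat W w ->
    forall T, (2 <= T)%N ->
      exists2 u, argmin W (cumulative_loss alpha f fhat T) u &
      \sum_(1 <= t < T.+1) f t (update alpha (fhat t) (w t))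
        - cumulative_loss alpha f fhat T u
      <= C * (32 * G ^+ 2 / mu * ln T%:R).
Proof.
(* With [L = 2 * G] and [m = mu / 32], the bound [L ^+ 2 / m * (3 * ln T)] is
   [384 * G ^+ 2 / mu * ln T], and [384 = 12 * 32]. *)
exists 12; split=> // d W G beta rho mu alpha f fhat w _ cW W0 G0 beta0 rho0 mu0.
move=> fA alpha0; rewrite le_min => /andP[].
rewrite ler_pdivlMr ?mulr_gt0// => alpha_beta.
rewrite ler_pdivlMr ?mulr_gt0// => alpha_rho UW [w1 leader] T T2.
have {}alpha_beta : alpha * beta <= 1 / 2 by lra.
have {}alpha_rho : alpha * (rho * G) <= mu / 8 by lra.
have T1 : (1 <= T)%N by exact: ltnW.
(* The minimum in the regret is attained at the play of the following round. *)
exists (w T.+1); first exact: leader.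
pose F t u := f t (update alpha (fhat t) u).
have lipF t : (1 <= t)%N -> forall x y, W x -> W y ->
    F t y - F t x <= 2 * G * enorm (y - x).
  move=> t1 x y Wx Wy; have [ft fht] := fA t t1.
  exact: (meta_loss_lipschitz cW W0 ft fht alpha0 alpha_beta (UW t t1) Wx Wy).
have midF t : (1 <= t)%N -> forall x y, W x -> W y ->
    2 * F t (2^-1 *: (x + y)) + mu / 32 * enorm (y - x) ^+ 2 <= F t x + F t y.
  move=> t1 x y Wx Wy; have [ft fht] := fA t t1.
  exact: (meta_loss_midpoint cW W0 mu0 ft fht alpha0 alpha_beta alpha_rho
    (UW t t1) Wx Wy).
have G20 : 0 <= 2 * G by rewrite mulr_ge0// ltW.
have m0 : 0 < mu / 32 by rewrite divr_gt0.
have [WT _] := leader T T1.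
apply: le_trans (ftl_regret cW G20 m0 lipF midF w1 leader T WT) _.
have -> : 12 * (32 * G ^+ 2 / mu * ln T%:R) =
    (2 * G) ^+ 2 / (mu / 32) * (3 * ln T%:R).
  by field; rewrite gt_eqF.
by rewrite ler_wpM2l ?harmonic_le_ln// divr_ge0 ?sqr_ge0// ltW.
Qed.
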